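(* Let $$A=\begin{bmatrix}0&0&0&1&0&0\\0&0&0&0&b&0\\0&0&0&0&c&e\\0&0&0&0&d&f\\0&0&0&0&0&g\\0&0&0&0&0&h\end{bmatrix},$$ where $b,c,d,e,h\ge0$, $f,g\in\mathbb R$, $f\ge0$ if $ce=0$ and $f\le0$ otherwise, $b^2+c^2+d^2=1$, $e^2+f^2+g^2+h^2=1$, $ce+df=0$, and $c=0$ whenever $e=0$. Suppose that either $c=d=0$ or $g=h=0$. Then the numerical range $W(A)$ is a circular disk if and only if $A$ is nilpotent.
   Context: $W(A)=\{\langle Ax,x\rangle:\|x\|=1\}$ is the numerical range of $A$. *)

(* Defs.v *)
From HB Require Import structures.
From mathcomp Require Import all_boot all_order all_algebra.
From mathcomp Require Import boolp classical_sets reals.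
From mathcomp.real_closed Require Import complex.

Set Implicit Arguments.
Unset Strict Implicit.
Unset Printing Implicit Defensive.

Import Order.TTheory GRing.Theory Num.Theory.

Local Open Scope classical_set_scope.
Local Open Scope ring_scope.
Local Open Scope complex_scope.

(* [dotmx] takes row vectors; it is linear in the first argument and
   conjugate-linear in the second. *)
Definition cdot (C : numClosedFieldType) (n : nat) (x y : 'cV[C]_n) : C :=
  dotmx x^T y^T.

Definition cnorm (C : numClosedFieldType) (n : nat) (x : 'cV[C]_n) : C :=
  sqrtC (cdot x x).

Definition numerical_range (C : numClosedFieldType) (n : nat) (A : 'M[C]_n) :
    set C :=
  [set cdot (A *m x) x | x in [set x : 'cV[C]_n | cnorm x = 1]].

(* The disk is closed, as numerical ranges of matrices are compact; its center
   is arbitrary and a single point does not count as a disk. *)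
Definition circular_disk (R : realType) (S : set R[i]) : Prop :=
  exists (z0 : R[i]) (r : R), 0 < r /\ S = [set z | `|z - z0| <= r%:C].

Definition nilpotent_mx (K : pzRingType) (n : nat) (A : 'M[K]_n) : Prop :=
  exists k : nat, A ^+ k = 0.

Definition mxA_rows (R : realType) (b c d e f g h : R) : seq (seq R) :=
  [:: [:: 0; 0; 0; 1; 0; 0];
      [:: 0; 0; 0; 0; b; 0];
      [:: 0; 0; 0; 0; c; e];
      [:: 0; 0; 0; 0; d; f];
      [:: 0; 0; 0; 0; 0; g];
      [:: 0; 0; 0; 0; 0; h]].

Definition mxA (R : realType) (b c d e f g h : R) : 'M[R[i]]_6 :=
  \matrix_(i < 6, j < 6) ((nth [::] (mxA_rows b c d e f g h) i)`_j)%:C.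

(* Main.v *)
Require Import Defs.
From mathcomp Require Import all_boot all_order all_algebra.
From mathcomp Require Import boolp classical_sets reals.
From mathcomp.real_closed Require Import complex.
From mathcomp Require Import ring lra.

(** The matrix is upper triangular with [h] as its only possibly nonzero
    eigenvalue, so it is nilpotent exactly when [h = 0]
    ([mxA_nilpotent]).

    Suppose [h = 0]. In both cases the basis vectors can be given degrees 0, 1
    and 2 so that [A] lowers the degree by one. Multiplying the degree [k] part
    of a unit vector by [w ^ k], with [w] of modulus one, then multiplies
    [<Ax, x>] by [w]: the numerical range is invariant under rotations about 0.
    In both cases, up to a complex conjugation, [<Ax, x>] has the form
      [x^* (y . v1) + s (y^* . v2) + t (y^* . v3)]
    with [v1, v2, v3] real unit vectors of dimension three and [v2] orthogonal
    to [v3] ([graded_values]). If [rho] is the length of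
    [(v1 . v2, v1 . v3)], the Gram matrix of [v1, v2, v3] has largest
    eigenvalue [1 + rho], so the real part of such a value is at most
    [tau / 2] with [tau ^ 2 = 1 + rho], and an eigenvector,
    rescaled between its middle and outer degrees, produces every real number
    between 0 and [tau / 2]. Hence the set of values is the disk of center 0 and
    radius [tau / 2] ([graded_values_disk]).

    Suppose [h > 0], which forces [c = d = 0] and [b = 1], and suppose that the
    numerical range is the disk of center [al + i be] and radius [r]. After
    absorbing phases into the coordinates, the support function of the
    numerical range in the direction [(c, s)] is the largest eigenvalue of the
    real quadratic form [formQ e f g (h c)]; so this eigenvalue is
    [r + al c + be s] for every [(c, s)] on the unit circle ([disk_is_top]).
    The eigenvalue is at least 1/2. If [f = g = 0], it equals 1/2 whenever
    [c <= 0], which forces [al = be = 0] and [r = 1/2], whereas it is at least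
    [(1 + h) / 2] at [c = 1]. Otherwise it is greater than 1/2 and is a root of
    the quartic of [is_top_charpoly]. The directions [(0, 1)] and [(0, -1)] give
    [be = 0]; the quartic is then a polynomial of degree at most four in [c]
    vanishing at five points, hence zero. Its leading coefficient gives [al = 0]
    or [al = h], and both are excluded by a lower coefficient
    ([top_not_affine]). *)

Set Implicit Arguments.
Unset Strict Implicit.
Unset Printing Implicit Defensive.

Import Order.TTheory GRing.Theory Num.Theory.
Local Open Scope ring_scope.
Local Open Scope complex_scope.

(* The conjugation of [R[i]] as a function on pairs, which computes; the
   notation with a plain star may also denote the one of an abstract
   algebraically closed field, to which it is convertible. *)
Local Notation "z ^*c" := (conjc z)
  (at level 1, left associativity, format "z ^*c") : ring_scope.

(** * The numerical range and nilpotency in coordinates *)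

Lemma cdotE (R : realType) (n : nat) (x y : 'cV[R[i]]_n) :
  cdot x y = \sum_k x k 0 * (y k 0)^*c.
Proof. by rewrite /cdot dotmxE mxE; apply: eq_bigr => k _; rewrite !mxE. Qed.

Lemma cnorm_eq1 (R : realType) (n : nat) (x : 'cV[R[i]]_n) :
  cnorm x = 1 <-> \sum_k x k 0 * (x k 0)^*c = 1.
Proof.
rewrite /cnorm -cdotE; split=> [h1|->]; last exact: sqrtC1.
by rewrite -[LHS]sqrtCK h1 expr1n.
Qed.

(** The column vector with the given six entries. *)
Definition col6 (R : realType) (x1 x2 x3 x4 x5 x6 : R[i]) : 'cV[R[i]]_6 :=
  \col_k [:: x1; x2; x3; x4; x5; x6]`_k.

Lemma numerical_rangeP (R : realType) (b c d e f g h : R) (z : R[i]) :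
  numerical_range (mxA b c d e f g h) z <->
  exists x1 x2 x3 x4 x5 x6 : R[i],
    x1 * x1^*c + x2 * x2^*c + x3 * x3^*c + x4 * x4^*c + x5 * x5^*c + x6 * x6^*c = 1
    /\ z = x4 * x1^*c + b%:C * x5 * x2^*c + (c%:C * x5 + e%:C * x6) * x3^*c
           + (d%:C * x5 + f%:C * x6) * x4^*c + g%:C * x6 * x5^*c
           + h%:C * x6 * x6^*c.
Proof.
have row0 (x : 'cV[R[i]]_6) i : (mxA b c d e f g h *m x) i 0 =
    \sum_(j < 6) ((nth [::] (mxA_rows b c d e f g h) i)`_j)%:C * x j 0.
  by rewrite mxE; apply: eq_bigr => j _; rewrite mxE.
split.
  case=> x /= /cnorm_eq1 x1 <-.
  move: x1; rewrite cdotE !big_ord_recr !big_ord0 /= !add0r => x1.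
  rewrite !row0 !big_ord_recr !big_ord0 /= => {row0}.
  do 6 eexists; split; first exact: x1.
  rewrite !rmorph0 !rmorph1; ring.
case=> x1 [x2 [x3 [x4 [x5 [x6 [hx ->]]]]]].
exists (col6 x1 x2 x3 x4 x5 x6) => /=.
  by apply/cnorm_eq1; rewrite !big_ord_recr !big_ord0 /= !mxE /= add0r.
rewrite cdotE !big_ord_recr !big_ord0 /= !row0 !big_ord_recr !big_ord0 /=.
rewrite !mxE /= !rmorph0 !rmorph1; ring.
Qed.

(** The [k]-th power vanishes on and below the [(k - 1)]-st superdiagonal. *)
Lemma strict_upper_nilpotent (K : pzRingType) (n : nat) (A : 'M[K]_n) :
  (forall i j : 'I_n, (j <= i)%N -> A i j = 0) -> nilpotent_mx A.
Proof.
move=> A0.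
have Ak0 k (i j : 'I_n) : (j < i + k)%N -> (A ^+ k) i j = 0.
  elim: k i j => [|k IHk] i j.
    rewrite addn0 => ltji; rewrite expr0 mxE.
    by case: eqP => // eij; rewrite eij ltnn in ltji.
  rewrite addnS ltnS => leji; rewrite exprS mxE big1 // => l _.
  have [leli|ltil] := leqP l i; first by rewrite A0 ?mul0r.
  by rewrite IHk ?mulr0 // (leq_ltn_trans leji) // ltn_add2r.
exists n; apply/matrixP => i j; rewrite [RHS]mxE Ak0 //.
exact: ltn_addl.
Qed.

Lemma mxA_exp_last (R : realType) (b c d e f g h : R) (k : nat) :
  (mxA b c d e f g h ^+ k) ord_max ord_max = h%:C ^+ k.
Proof.
elim: k => [|k IHk]; first by rewrite !expr0 mxE.
rewrite !exprS mxE !big_ord_recr big_ord0 /= !mxE /=.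
by rewrite IHk !rmorph0 !mul0r !add0r.
Qed.

Lemma mxA_nilpotent (R : realType) (b c d e f g h : R) :
  nilpotent_mx (mxA b c d e f g h) <-> h = 0.
Proof.
split=> [[k Ak0]|->].
  have := mxA_exp_last b c d e f g h k; rewrite Ak0 mxE => /esym/eqP.
  by rewrite expf_eq0 => /andP[_ /eqP/complexI].
apply: strict_upper_nilpotent => i j; rewrite mxE.
by case: i => -[|[|[|[|[|[|i]]]]]] //= _; case: j => -[|[|[|[|[|[|j]]]]]].
Qed.

(** * Graded sesquilinear values fill a disk *)

(** Polar coordinates in the plane, without angles. *)
Lemma real_polar (R : realType) (p q : R) :
  exists p' q' : R, [/\ p' ^+ 2 + q' ^+ 2 = 1,
    p = Num.sqrt (p ^+ 2 + q ^+ 2) * p' & q = Num.sqrt (p ^+ 2 + q ^+ 2) * q'].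
Proof.
have s_ge0 : 0 <= p ^+ 2 + q ^+ 2 by rewrite addr_ge0 ?sqr_ge0.
set rho := Num.sqrt _; have rho2 : rho ^+ 2 = p ^+ 2 + q ^+ 2 by rewrite sqr_sqrtr.
have [rho0|rhoN0] := eqVneq rho 0.
  exists 1, 0; rewrite rho0 !mul0r expr1n expr0n addr0.
  have: p ^+ 2 + q ^+ 2 = 0 by rewrite -rho2 rho0 expr0n.
  by move/eqP; rewrite paddr_eq0 ?sqr_ge0 // !sqrf_eq0 => /andP[/eqP-> /eqP->].
exists (p / rho), (q / rho); split; [|by rewrite mulrC divfK..].
by rewrite !expr_div_n -mulrDl -rho2 divff // sqrf_eq0.
Qed.

(** With [u = x v1 + s v2 + t v3], this follows from [0 <= |tau y - u|^2] and
    [|u|^2 <= (1 + rho) (x^2 + s^2 + t^2)]. *)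
Lemma graded_bound_real (R : realType) (a1 a2 a3 b1 b2 b3 c1 c2 c3 : R)
    (rho tau p q x y1 y2 y3 s t : R) :
  a1 ^+ 2 + a2 ^+ 2 + a3 ^+ 2 = 1 -> b1 ^+ 2 + b2 ^+ 2 + b3 ^+ 2 = 1 ->
  c1 ^+ 2 + c2 ^+ 2 + c3 ^+ 2 = 1 -> b1 * c1 + b2 * c2 + b3 * c3 = 0 ->
  0 <= rho -> p ^+ 2 + q ^+ 2 = 1 ->
  a1 * b1 + a2 * b2 + a3 * b3 = rho * p ->
  a1 * c1 + a2 * c2 + a3 * c3 = rho * q ->
  0 < tau -> tau ^+ 2 = 1 + rho ->
  2 * (y1 * (a1 * x + b1 * s + c1 * t) + y2 * (a2 * x + b2 * s + c2 * t)
     + y3 * (a3 * x + b3 * s + c3 * t))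
  <= tau * (x ^+ 2 + y1 ^+ 2 + y2 ^+ 2 + y3 ^+ 2 + s ^+ 2 + t ^+ 2).
Proof.
move=> ha hb hc bc0 rho0 pq1 ab ac tau0 tau2.
set u1 := a1 * x + _ + _; set u2 := a2 * x + _ + _; set u3 := a3 * x + _ + _.
rewrite -(ler_pM2l tau0).
have sq0 : 0 <= (tau * y1 - u1) ^+ 2 + (tau * y2 - u2) ^+ 2
              + (tau * y3 - u3) ^+ 2 by rewrite !addr_ge0 ?sqr_ge0.
have u2E : u1 ^+ 2 + u2 ^+ 2 + u3 ^+ 2
    = x ^+ 2 + s ^+ 2 + t ^+ 2 + rho * (2 * x * (p * s + q * t)).
  transitivity ((a1 ^+ 2 + a2 ^+ 2 + a3 ^+ 2) * x ^+ 2
    + (b1 ^+ 2 + b2 ^+ 2 + b3 ^+ 2) * s ^+ 2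
    + (c1 ^+ 2 + c2 ^+ 2 + c3 ^+ 2) * t ^+ 2
    + 2 * x * ((a1 * b1 + a2 * b2 + a3 * b3) * s
             + (a1 * c1 + a2 * c2 + a3 * c3) * t)
    + 2 * s * t * (b1 * c1 + b2 * c2 + b3 * c3)); first by rewrite /u1 /u2 /u3; ring.
  by rewrite ha hb hc bc0 ab ac; ring.
(* Cauchy-Schwarz for the unit vector (p, q), then the inequality of means *)
have cs : rho * (2 * x * (p * s + q * t)) <= rho * (x ^+ 2 + s ^+ 2 + t ^+ 2).
  apply: ler_wpM2l => //.
  have e1 : s ^+ 2 + t ^+ 2 = (p * s + q * t) ^+ 2 + (p * t - q * s) ^+ 2.
    by transitivity ((p ^+ 2 + q ^+ 2) * (s ^+ 2 + t ^+ 2));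
      [rewrite pq1 mul1r | ring].
  have := sqr_ge0 (x - (p * s + q * t)); have := sqr_ge0 (p * t - q * s).
  by rewrite -addrA e1 => h1 h2; nra.
rewrite [leRHS]mulrA -expr2 tau2.
have e2 : (tau * y1 - u1) ^+ 2 + (tau * y2 - u2) ^+ 2 + (tau * y3 - u3) ^+ 2
  = tau ^+ 2 * (y1 ^+ 2 + y2 ^+ 2 + y3 ^+ 2)
  + (u1 ^+ 2 + u2 ^+ 2 + u3 ^+ 2)
  - tau * (2 * (y1 * u1 + y2 * u2 + y3 * u3)) by ring.
rewrite e2 u2E tau2 in sq0; lra.
Qed.

(** Values on unit vectors [(x, y, s, t)] of the form
    [x^* (y . v1) + s (y^* . v2) + t (y^* . v3)], where [y] has three complex
    coordinates and [v1, v2, v3] are the real vectors [(a1, a2, a3)],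
    [(b1, b2, b3)], [(c1, c2, c3)]. *)
Definition graded_values (R : realType) (a1 a2 a3 b1 b2 b3 c1 c2 c3 : R) :
    set R[i] :=
  [set z | exists x y1 y2 y3 s t : R[i],
    x * x^*c + y1 * y1^*c + y2 * y2^*c + y3 * y3^*c + s * s^*c + t * t^*c = 1
    /\ z = x^*c * (a1%:C * y1 + a2%:C * y2 + a3%:C * y3)
         + s * (b1%:C * y1^*c + b2%:C * y2^*c + b3%:C * y3^*c)
         + t * (c1%:C * y1^*c + c2%:C * y2^*c + c3%:C * y3^*c)]%classic.

(** Here [x] has degree 0, [y] has degree 1, and [s], [t] have degree 2. *)
Lemma graded_values_rot (R : realType) (a1 a2 a3 b1 b2 b3 c1 c2 c3 : R)
    (w z : R[i]) :
  w * w^*c = 1 ->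
  graded_values a1 a2 a3 b1 b2 b3 c1 c2 c3 z ->
  graded_values a1 a2 a3 b1 b2 b3 c1 c2 c3 (w * z).
Proof.
move=> w1 [x [y1 [y2 [y3 [s [t [n1 ->]]]]]]].
exists x, (w * y1), (w * y2), (w * y3), (w ^+ 2 * s), (w ^+ 2 * t).
have conjM (u v : R[i]) : (u * v)^*c = u^*c * v^*c by exact: rmorphM.
rewrite expr2 !conjM; move: (w^*c) w1 => v w1.
split.
  rewrite -[RHS]n1.
  transitivity (x * x^*c + w * v * (y1 * y1^*c + y2 * y2^*c + y3 * y3^*c)
    + (w * v) ^+ 2 * (s * s^*c + t * t^*c)); first by ring.
  by rewrite w1; ring.
rewrite !mulrDr.
transitivity (w * (x^*c * (a1%:C * y1 + a2%:C * y2 + a3%:C * y3))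
         + w * (w * v) * s * (b1%:C * y1^*c + b2%:C * y2^*c + b3%:C * y3^*c)
         + w * (w * v) * t * (c1%:C * y1^*c + c2%:C * y2^*c + c3%:C * y3^*c)).
  by rewrite w1; ring.
by ring.
Qed.

(** The real part of a value is the sum of the real forms of
    [graded_bound_real] at the real and at the imaginary parts. *)
Lemma graded_values_Re (R : realType) (a1 a2 a3 b1 b2 b3 c1 c2 c3 : R)
    (rho tau p q : R) (z : R[i]) :
  a1 ^+ 2 + a2 ^+ 2 + a3 ^+ 2 = 1 -> b1 ^+ 2 + b2 ^+ 2 + b3 ^+ 2 = 1 ->
  c1 ^+ 2 + c2 ^+ 2 + c3 ^+ 2 = 1 -> b1 * c1 + b2 * c2 + b3 * c3 = 0 ->
  0 <= rho -> p ^+ 2 + q ^+ 2 = 1 ->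
  a1 * b1 + a2 * b2 + a3 * b3 = rho * p ->
  a1 * c1 + a2 * c2 + a3 * c3 = rho * q ->
  0 < tau -> tau ^+ 2 = 1 + rho ->
  graded_values a1 a2 a3 b1 b2 b3 c1 c2 c3 z -> complex.Re z <= tau / 2.
Proof.
move=> ha hb hc bc0 rho0 pq1 ab ac tau0 tau2 [x [y1 [y2 [y3 [s [t [n1 ->]]]]]]].
have B := graded_bound_real _ _ _ _ _ _ ha hb hc bc0 rho0 pq1 ab ac tau0 tau2.
case: x y1 y2 y3 s t n1 => [x x'] [y1 y1'] [y2 y2'] [y3 y3'] [s s'] [t t'] /=.
move=> /(congr1 (@complex.Re R)) /= n1.
have := B x y1 y2 y3 s t; have := B x' y1' y2' y3' s' t'.
have := congr1 ( *%R tau) n1; rewrite mulr1 => n1t B1 B2; lra.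
Qed.

Lemma graded_values_real (R : realType) (a1 a2 a3 b1 b2 b3 c1 c2 c3 : R)
    (rho tau p q r : R) :
  a1 ^+ 2 + a2 ^+ 2 + a3 ^+ 2 = 1 -> b1 ^+ 2 + b2 ^+ 2 + b3 ^+ 2 = 1 ->
  c1 ^+ 2 + c2 ^+ 2 + c3 ^+ 2 = 1 -> b1 * c1 + b2 * c2 + b3 * c3 = 0 ->
  p ^+ 2 + q ^+ 2 = 1 ->
  a1 * b1 + a2 * b2 + a3 * b3 = rho * p ->
  a1 * c1 + a2 * c2 + a3 * c3 = rho * q ->
  0 < tau -> tau ^+ 2 = 1 + rho -> 0 <= r <= tau / 2 ->
  graded_values a1 a2 a3 b1 b2 b3 c1 c2 c3 r%:C.
Proof.
move=> ha hb hc bc0 pq1 ab ac tau0 tau2 /andP[r0 rtau].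
have tauN0 : tau != 0 by rewrite gt_eqF.
(* The value is the maximum [tau / 2] times [A B], where [A] scales [x, s, t]
   and [B] scales [y]; the norm is kept when [A^2 + B^2 = 2]. Thus [A + B] and
   [A - B] are the square roots of [2 + 2 k] and [2 - 2 k], with [k = A B]. *)
pose k := 2 * r / tau.
have k0 : 0 <= k by rewrite divr_ge0 ?mulr_ge0 // ltW.
have k1 : k <= 1 by rewrite ler_pdivrMr // mul1r; lra.
pose m := Num.sqrt (2 + 2 * k); pose n := Num.sqrt (2 - 2 * k).
have m2 : m ^+ 2 = 2 + 2 * k by rewrite sqr_sqrtr //; lra.
have n2 : n ^+ 2 = 2 - 2 * k by rewrite sqr_sqrtr //; lra.
pose A := (m + n) / 2; pose B := (m - n) / 2.
have AB : A * B = k.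
  by transitivity ((m ^+ 2 - n ^+ 2) / 4); [rewrite /A /B; field | rewrite m2 n2; field].
have A2B2 : A ^+ 2 + B ^+ 2 = 2.
  by transitivity ((m ^+ 2 + n ^+ 2) / 2); [rewrite /A /B; field | rewrite m2 n2; field].
(* [(1, p, q)] is an eigenvector of the Gram matrix of [v1, v2, v3] for its
   largest eigenvalue [1 + rho]. *)
pose u1 := a1 + b1 * p + c1 * q; pose u2 := a2 + b2 * p + c2 * q.
pose u3 := a3 + b3 * p + c3 * q.
have uu : u1 ^+ 2 + u2 ^+ 2 + u3 ^+ 2 = 2 * tau ^+ 2.
  transitivity ((a1 ^+ 2 + a2 ^+ 2 + a3 ^+ 2)
    + (b1 ^+ 2 + b2 ^+ 2 + b3 ^+ 2) * p ^+ 2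
    + (c1 ^+ 2 + c2 ^+ 2 + c3 ^+ 2) * q ^+ 2
    + 2 * ((a1 * b1 + a2 * b2 + a3 * b3) * p
             + (a1 * c1 + a2 * c2 + a3 * c3) * q)
    + 2 * p * q * (b1 * c1 + b2 * c2 + b3 * c3)); first by rewrite /u1 /u2 /u3; ring.
  rewrite ha hb hc bc0 ab ac tau2.
  transitivity (1 + (p ^+ 2 + q ^+ 2) + 2 * rho * (p ^+ 2 + q ^+ 2)); first by ring.
  by rewrite pq1; ring.
pose B' := B / (2 * tau).
have B'E : B = 2 * tau * B' by rewrite /B' mulrC divfK // mulf_neq0 // pnatr_eq0.
have rE : r = A / 2 * B' * (2 * tau ^+ 2).
  transitivity (k * tau / 2); first by rewrite /k; field.
  by rewrite -AB B'E; field.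
exists (A / 2)%:C, (B' * u1)%:C, (B' * u2)%:C, (B' * u3)%:C,
  (A / 2 * p)%:C, (A / 2 * q)%:C.
rewrite !conjc_real -!rmorphM -!rmorphD -!rmorphM -!rmorphD -(rmorph1 (real_complex R)).
split; congr _%:C; last first.
  by rewrite rE -uu /u1 /u2 /u3; ring.
transitivity ((A ^+ 2 / 4) * (1 + (p ^+ 2 + q ^+ 2)) + B' ^+ 2 * (u1 ^+ 2 + u2 ^+ 2 + u3 ^+ 2)).
  by field.
rewrite pq1 uu.
transitivity ((A ^+ 2 + B ^+ 2) / 2); last by rewrite A2B2; field.
by rewrite B'E; field.
Qed.

Lemma complex_polar (R : realType) (z : R[i]) :
  exists w : R[i], w * w^*c = 1 /\ z = w * `|z|.
Proof.
have [->|zN0] := eqVneq z 0.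
  by exists 1; rewrite normr0 mulr0 rmorph1 mulr1.
have nN0 : `|z| != 0 by rewrite normr_eq0.
exists (z / `|z|); rewrite divfK //; split => //.
by rewrite -sqr_normc normrM normfV normr_id divff // expr1n.
Qed.

Lemma graded_values_disk (R : realType) (a1 a2 a3 b1 b2 b3 c1 c2 c3 : R) :
  a1 ^+ 2 + a2 ^+ 2 + a3 ^+ 2 = 1 -> b1 ^+ 2 + b2 ^+ 2 + b3 ^+ 2 = 1 ->
  c1 ^+ 2 + c2 ^+ 2 + c3 ^+ 2 = 1 -> b1 * c1 + b2 * c2 + b3 * c3 = 0 ->
  exists2 r : R, 0 < r & forall z,
    graded_values a1 a2 a3 b1 b2 b3 c1 c2 c3 z <-> `|z| <= r%:C.
Proof.
move=> ha hb hc bc0.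
have [p [q [pq1]]] := real_polar (a1 * b1 + a2 * b2 + a3 * b3)
  (a1 * c1 + a2 * c2 + a3 * c3).
set rho := Num.sqrt _ => ab ac.
have rho0 : 0 <= rho by exact: sqrtr_ge0.
pose tau := Num.sqrt (1 + rho).
have tau0 : 0 < tau by rewrite sqrtr_gt0; lra.
have tau2 : tau ^+ 2 = 1 + rho by rewrite sqr_sqrtr //; lra.
exists (tau / 2) => [|z]; first by rewrite divr_gt0.
have [w [w1 zE]] := complex_polar z.
have [n n0 nE] : exists2 n : R, 0 <= n & `|z| = n%:C.
  exists (Num.sqrt (complex.Re z ^+ 2 + complex.Im z ^+ 2)).
    exact: sqrtr_ge0.
  exact: normc_def.
split=> [gz|]; rewrite nE lecR.
  apply: (graded_values_Re ha hb hc bc0 rho0 pq1 ab ac tau0 tau2 (z := n%:C)).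
  have -> : n%:C = w^*c * z by rewrite zE mulrA [w^*c * w]mulrC w1 mul1r nE.
  by apply: graded_values_rot gz; rewrite conjcK mulrC.
move=> nr; rewrite zE nE; apply: graded_values_rot => //.
apply: (graded_values_real ha hb hc bc0 pq1 ab ac tau0 tau2).
exact/andP.
Qed.

(** * The largest eigenvalue of a real quadratic form *)

(** First order condition at a minimum. *)
Lemma linear_coef_eq0 (R : realFieldType) (a l : R) :
  (forall t : R, 0 <= t * l + t ^+ 2 * a) -> l = 0.
Proof.
move=> H.
have a1 : 0 < 1 + `|a| by have := normr_ge0 a; lra.
have := H (- l / (1 + `|a|)).
have -> : - l / (1 + `|a|) * l + (- l / (1 + `|a|)) ^+ 2 * a
  = - (l / (1 + `|a|)) ^+ 2 * (1 + (`|a| - a)) by field; rewrite gt_eqF.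
have := ler_norm a; set w := l / _ => h1 h2.
have w0 : w ^+ 2 = 0 by apply/eqP; rewrite eq_le sqr_ge0 andbT; nra.
move/eqP: w0; rewrite sqrf_eq0 mulf_eq0 invr_eq0 (gt_eqF a1) orbF.
by move/eqP.
Qed.

(** The form [Re (w^-1 <Ax, x>)] in the case [c = d = 0], [b = 1] and [w] of
    modulus one, once phases are absorbed in the coordinates; [k] stands for
    [h] times the real part of [w]. *)
Definition formQ (R : realFieldType) (e f g k x1 x2 x3 x4 x5 x6 : R) : R :=
  x4 * x1 + x5 * x2 + (e * x3 + f * x4 + g * x5) * x6 + k * x6 ^+ 2.

Definition sqnorm6 (R : realFieldType) (x1 x2 x3 x4 x5 x6 : R) : R :=
  x1 ^+ 2 + x2 ^+ 2 + x3 ^+ 2 + x4 ^+ 2 + x5 ^+ 2 + x6 ^+ 2.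

(** [l] is the largest eigenvalue of [formQ], expressed as an attained maximum
    of the Rayleigh quotient. *)
Definition is_top (R : realFieldType) (e f g k l : R) : Prop :=
  (forall x1 x2 x3 x4 x5 x6 : R,
    formQ e f g k x1 x2 x3 x4 x5 x6 <= l * sqnorm6 x1 x2 x3 x4 x5 x6) /\
  (exists x1 x2 x3 x4 x5 x6 : R, sqnorm6 x1 x2 x3 x4 x5 x6 != 0 /\
    formQ e f g k x1 x2 x3 x4 x5 x6 = l * sqnorm6 x1 x2 x3 x4 x5 x6).

Lemma is_top_ge_half (R : realFieldType) (e f g k l : R) :
  is_top e f g k l -> 2^-1 <= l.
Proof.
by move=> [/(_ 1 0 0 1 0 0) H _]; move: H; rewrite /formQ /sqnorm6; lra.
Qed.

Lemma is_top_half (R : realFieldType) (e f g k : R) :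
  is_top e f g k 2^-1 -> f = 0 /\ g = 0.
Proof.
move=> [H _].
have : - (f ^+ 2 + g ^+ 2) = 0.
  apply: (@linear_coef_eq0 _ (2^-1 - k)) => t.
  by have := H f g 0 f g t; rewrite /formQ /sqnorm6; lra.
move/eqP; rewrite oppr_eq0 paddr_eq0 ?sqr_ge0 // !sqrf_eq0.
by move=> /andP[/eqP-> /eqP->].
Qed.

(** Up to constants, the characteristic polynomial is the product of this
    quartic and of [4 l^2 - 1], which is nonzero here. The quartic is obtained
    by eliminating all coordinates but [x6] from the eigenvector equations. *)
Lemma is_top_charpoly (R : realFieldType) (e f g k l : R) :
  is_top e f g k l -> 2^-1 < l ->
  l * (l - k) * (4 * l ^+ 2 - 1) - (f ^+ 2 + g ^+ 2) * l ^+ 2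
    - e ^+ 2 / 4 * (4 * l ^+ 2 - 1) = 0.
Proof.
move=> [H [x1 [x2 [x3 [x4 [x5 [x6 [xN0 xE]]]]]]]] l2.
have l0 : 0 < l by lra.
have E1 : 2 * l * x1 - x4 = 0.
  apply: (@linear_coef_eq0 _ l) => t.
  by have := H (x1 + t) x2 x3 x4 x5 x6; move: xE; rewrite /formQ /sqnorm6; lra.
have E2 : 2 * l * x2 - x5 = 0.
  apply: (@linear_coef_eq0 _ l) => t.
  by have := H x1 (x2 + t) x3 x4 x5 x6; move: xE; rewrite /formQ /sqnorm6; lra.
have E3 : 2 * l * x3 - e * x6 = 0.
  apply: (@linear_coef_eq0 _ l) => t.
  by have := H x1 x2 (x3 + t) x4 x5 x6; move: xE; rewrite /formQ /sqnorm6; lra.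
have E4 : 2 * l * x4 - x1 - f * x6 = 0.
  apply: (@linear_coef_eq0 _ l) => t.
  by have := H x1 x2 x3 (x4 + t) x5 x6; move: xE; rewrite /formQ /sqnorm6; lra.
have E5 : 2 * l * x5 - x2 - g * x6 = 0.
  apply: (@linear_coef_eq0 _ l) => t.
  by have := H x1 x2 x3 x4 (x5 + t) x6; move: xE; rewrite /formQ /sqnorm6; lra.
have E6 : 2 * (l - k) * x6 - e * x3 - f * x4 - g * x5 = 0.
  apply: (@linear_coef_eq0 _ (l - k)) => t.
  by have := H x1 x2 x3 x4 x5 (x6 + t); move: xE; rewrite /formQ /sqnorm6; lra.
have m0 : 4 * l ^+ 2 - 1 != 0.
  by rewrite gt_eqF //; nra.
have F4 : (4 * l ^+ 2 - 1) * x4 = 2 * l * f * x6.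
  by have := congr1 ( *%R (2 * l)) E4; rewrite mulr0; lra.
have F5 : (4 * l ^+ 2 - 1) * x5 = 2 * l * g * x6.
  by have := congr1 ( *%R (2 * l)) E5; rewrite mulr0; lra.
have [x60|x6N0] := eqVneq x6 0.
  have x40 : x4 = 0 by apply: (mulfI m0); rewrite F4 x60; ring.
  have x50 : x5 = 0 by apply: (mulfI m0); rewrite F5 x60; ring.
  have lN : 2 * l != 0 by rewrite gt_eqF //; lra.
  have x10 : x1 = 0 by apply: (mulfI lN); lra.
  have x20 : x2 = 0 by apply: (mulfI lN); lra.
  have x30 : x3 = 0 by apply: (mulfI lN); move: E3; rewrite x60; lra.
  move: xN0; rewrite /sqnorm6 x10 x20 x30 x40 x50 x60.
  by rewrite !expr0n /= !addr0 eqxx.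
apply: (mulIf x6N0); rewrite mul0r.
transitivity ((l * (4 * l ^+ 2 - 1) * (2 * (l - k) * x6 - e * x3 - f * x4 - g * x5)
 + l * f * ((4 * l ^+ 2 - 1) * x4 - 2 * l * f * x6)
 + l * g * ((4 * l ^+ 2 - 1) * x5 - 2 * l * g * x6)
 + e / 2 * (4 * l ^+ 2 - 1) * (2 * l * x3 - e * x6)) / 2); first by field.
by rewrite F4 F5 E6 E3; field.
Qed.

Lemma top_not_affine (R : realFieldType) (e f g h r al be : R) :
  0 < h -> e ^+ 2 + f ^+ 2 + g ^+ 2 + h ^+ 2 = 1 ->
  ~ (forall c s : R, c ^+ 2 + s ^+ 2 = 1 ->
       is_top e f g (h * c) (r + al * c + be * s)).
Proof.
move=> h0 n1 T.
have half c s : c ^+ 2 + s ^+ 2 = 1 -> 2^-1 <= r + al * c + be * s.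
  by move/T/is_top_ge_half.
have [/andP[/eqP f0 /eqP g0]|S0] := boolP ((f == 0) && (g == 0)).
  subst f g; have eh : e ^+ 2 = 1 - h ^+ 2 by move: n1; rewrite !expr0n /=; lra.
  have low c s : c ^+ 2 + s ^+ 2 = 1 -> c <= 0 -> r + al * c + be * s = 2^-1.
    move=> cs c0; apply/eqP; rewrite eq_le (half _ _ cs) andbT leNgt.
    apply/negP => l2.
    have := is_top_charpoly (T _ _ cs) l2; set l := r + _ + _ in l2 *.
    rewrite expr0n /= addr0 mul0r subr0 eh.
    have hc : h * c <= 0 by rewrite pmulr_rle0.
    have l21 : 0 < 4 * l ^+ 2 - 1 by nra.
    have : 0 < l * (l - h * c) - (1 - h ^+ 2) / 4 by nra.
    by move=> l3; have := mulr_gt0 l3 l21; lra.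
  have A1 : r + al * 0 + be * 1 = 2^-1 by apply: low; lra.
  have A2 : r + al * 0 + be * (-1) = 2^-1 by apply: low; lra.
  have A3 : r + al * (-1) + be * 0 = 2^-1 by apply: low; lra.
  have [H _] : is_top e 0 0 (h * 1) (r + al * 1 + be * 0).
    by apply: T; rewrite expr0n expr1n addr0.
  (* an eigenvector of the block of [x3, x6] for the eigenvalue [(1 + h) / 2] *)
  have := H 0 0 e 0 0 (1 + h); rewrite /formQ /sqnorm6 !expr0n /= eh.
  have -> : r + al * 1 + be * 0 = 2^-1 by lra.
  by nra.
have S1 : 0 < f ^+ 2 + g ^+ 2.
  rewrite lt_def addr_ge0 ?sqr_ge0 // andbT paddr_eq0 ?sqr_ge0 //.
  by rewrite !sqrf_eq0.
have gthalf c s : c ^+ 2 + s ^+ 2 = 1 -> 2^-1 < r + al * c + be * s.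
  move=> cs; rewrite lt_def (half _ _ cs) andbT; apply/eqP => l2.
  have := T _ _ cs; rewrite l2 => /is_top_half[f0 g0].
  by move: S0; rewrite f0 g0 eqxx.
have D c s cs := is_top_charpoly (T c s cs) (gthalf c s cs).
have cs1 : (0:R) ^+ 2 + 1 ^+ 2 = 1 by rewrite expr0n expr1n add0r.
have cs2 : (0:R) ^+ 2 + (-1) ^+ 2 = 1 by rewrite expr0n sqrrN expr1n add0r.
have be0 : be = 0.
  move: (D _ _ cs1) (D _ _ cs2) (gthalf _ _ cs1) (gthalf _ _ cs2).
  rewrite !mulr0 !addr0 !subr0 mulr1 mulrN1.
  set u := r + be; set v := r - be => Du Dv u2 v2.
  suff u2v2 : u ^+ 2 = v ^+ 2.
    have uvN0 : u + v != 0 by rewrite gt_eqF //; lra.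
    have : u = v by apply: (mulfI uvN0); lra.
    by rewrite /u /v; lra.
  apply/eqP; rewrite -subr_eq0; apply/negPn/negP => uvN0.
  (* [u ^+ 2] and [v ^+ 2] would be the two roots of a quadratic polynomial that
     is negative at 1/4, while both exceed 1/4. *)
  have sumE : 4 * (u ^+ 2 + v ^+ 2) = 1 + (f ^+ 2 + g ^+ 2) + e ^+ 2.
    by apply: (mulfI uvN0); lra.
  have prodE : 16 * (u ^+ 2 * v ^+ 2) = e ^+ 2.
    by have := congr1 ( *%R (u ^+ 2)) sumE; lra.
  have u1 : 0 < 4 * u ^+ 2 - 1 by nra.
  have v1 : 0 < 4 * v ^+ 2 - 1 by nra.
  by have := mulr_gt0 u1 v1; lra.
(* The five values [0, 1, -1, 3/5, -3/5] of [c] lie on rational points of the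
   unit circle, and determine a polynomial of degree four in [c]. *)
have cs3 : (1:R) ^+ 2 + 0 ^+ 2 = 1 by rewrite expr0n expr1n addr0.
have cs4 : (-1:R) ^+ 2 + 0 ^+ 2 = 1 by rewrite expr0n sqrrN expr1n addr0.
have cs5 : (3 / 5 : R) ^+ 2 + (4 / 5) ^+ 2 = 1 by field.
have cs6 : (- (3 / 5) : R) ^+ 2 + (4 / 5) ^+ 2 = 1 by field.
have r2 : 2^-1 < r by have := gthalf _ _ cs1; rewrite be0; lra.
have r4 : 0 < 4 * r ^+ 2 - 1 by nra.
have r0 : 0 < r by lra.
move: (D _ _ cs1) (D _ _ cs3) (D _ _ cs4) (D _ _ cs5) (D _ _ cs6).
rewrite be0 => D0 D1 D2 D3 D4.
(* the coefficient of degree four *)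
have al3 : al ^+ 3 * (al - h) = 0 by lra.
move/eqP: al3; rewrite mulf_eq0 expf_eq0 /= subr_eq0 => /orP[] /eqP alE; subst al.
  (* the coefficient of degree one *)
  by have := mulr_gt0 (mulr_gt0 r0 h0) r4; lra.
(* the coefficient of degree three *)
have h3 : 0 < h ^+ 3 by rewrite exprn_gt0.
by have := mulr_gt0 r0 h3; lra.
Qed.

(** * From the numerical range to the real forms *)

Lemma circular_disk_at0 (R : realType) (S : set R[i]) (r : R) :
  0 < r -> (forall z, S z <-> `|z| <= r%:C) -> circular_disk S.
Proof.
move=> r0 SE; exists 0, r; split=> //.
by apply/seteqP; split=> z /=; rewrite subr0 => /SE.
Qed.

Lemma mxA_disk_gh0 (R : realType) (b c d e f : R) :
  b ^+ 2 + c ^+ 2 + d ^+ 2 = 1 -> e ^+ 2 + f ^+ 2 = 1 -> c * e + d * f = 0 ->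
  circular_disk (numerical_range (mxA b c d e f 0 0)).
Proof.
move=> hbcd hef horth.
have [r r0 rE] : exists2 r : R, 0 < r & forall z,
    graded_values 0 0 1 b c d 0 e f z <-> `|z| <= r%:C.
  by apply: graded_values_disk; lra.
apply: (circular_disk_at0 r0) => z; rewrite -rE numerical_rangeP.
by split=> -[x1 [x2 [x3 [x4 [x5 [x6 [n1 ->]]]]]]];
  exists x1, x2, x3, x4, x5, x6; split=> //; rewrite !rmorph0 !rmorph1; ring.
Qed.

Lemma mxA_disk_cdh0 (R : realType) (e f g : R) :
  e ^+ 2 + f ^+ 2 + g ^+ 2 = 1 ->
  circular_disk (numerical_range (mxA 1 0 0 e f g 0)).
Proof.
move=> hefg.
have [r r0 rE] : exists2 r : R, 0 < r & forall z,
    graded_values e f g 0 1 0 0 0 1 z <-> `|z| <= r%:C.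
  by apply: graded_values_disk; lra.
apply: (circular_disk_at0 r0) => z.
rewrite -normcJ -rE numerical_rangeP.
have conjE : {morph (@conjc R) : u v / u * v >-> u * v} by exact: rmorphM.
have conjD : {morph (@conjc R) : u v / u + v >-> u + v} by exact: rmorphD.
split=> [[x1 [x2 [x3 [x4 [x5 [x6 [n1 ->]]]]]]]|
         [x6 [x3 [x4 [x5 [x1 [x2 [n1 /(congr1 (@conjc R))]]]]]]]].
  exists x6, x3, x4, x5, x1, x2; split; first by rewrite -n1; ring.
  by rewrite !(conjE, conjD, conjc_real, conjcK) !rmorph0 !rmorph1; ring.
rewrite conjcK => ->.
exists x1, x2, x3, x4, x5, x6; split; first by rewrite -n1; ring.
by rewrite !(conjE, conjD, conjc_real, conjcK) !rmorph0 !rmorph1; ring.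
Qed.

(** Change of variables [x1 = w^-2 y1], [x2 = w^-2 y2], [xj = w^-1 yj] for
    [j = 3, 4, 5], and [x6 = y6]. *)
Lemma numerical_range_phase (R : realType) (e f g h : R) (w z : R[i]) :
  w * w^*c = 1 ->
  numerical_range (mxA 1 0 0 e f g h) z <->
  exists y1 y2 y3 y4 y5 y6 : R[i],
    y1 * y1^*c + y2 * y2^*c + y3 * y3^*c + y4 * y4^*c + y5 * y5^*c
      + y6 * y6^*c = 1
    /\ z = w * (y4 * y1^*c + y5 * y2^*c
             + (e%:C * y3^*c + f%:C * y4^*c + g%:C * y5^*c) * y6)
           + h%:C * (y6 * y6^*c).
Proof.
move=> w1.
have conjE : {morph (@conjc R) : u v / u * v >-> u * v} by exact: rmorphM.
rewrite numerical_rangeP.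
split=> -[x1 [x2 [x3 [x4 [x5 [x6 [n1 ->]]]]]]].
  exists (w * w * x1), (w * w * x2), (w * x3), (w * x4), (w * x5), x6.
  rewrite !conjE; move: (w^*c) w1 => v w1; rewrite !rmorph0 !rmorph1; split.
    rewrite -[RHS]n1.
    transitivity ((w * v) ^+ 2 * (x1 * x1^*c + x2 * x2^*c)
      + w * v * (x3 * x3^*c + x4 * x4^*c + x5 * x5^*c) + x6 * x6^*c); first by ring.
    by rewrite w1; ring.
  transitivity ((w * v) ^+ 2 * (x4 * x1^*c + x5 * x2^*c)
     + w * v * ((e%:C * x3^*c + f%:C * x4^*c + g%:C * x5^*c) * x6)
     + h%:C * (x6 * x6^*c)); last by ring.
  by rewrite w1; ring.
exists (w^*c * w^*c * x1), (w^*c * w^*c * x2), (w^*c * x3), (w^*c * x4),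
  (w^*c * x5), x6.
rewrite !conjE conjcK; move: (w^*c) w1 => v w1; rewrite !rmorph0 !rmorph1; split.
  rewrite -[RHS]n1.
  transitivity ((w * v) ^+ 2 * (x1 * x1^*c + x2 * x2^*c)
    + w * v * (x3 * x3^*c + x4 * x4^*c + x5 * x5^*c) + x6 * x6^*c); first by ring.
  by rewrite w1; ring.
transitivity (w * (w * v * (x4 * x1^*c + x5 * x2^*c)
   + (e%:C * x3^*c + f%:C * x4^*c + g%:C * x5^*c) * x6)
   + h%:C * (x6 * x6^*c)); last by ring.
by rewrite w1; ring.
Qed.

(** The support function of a disk bounds the linear functionals on it. *)
Lemma disk_dir_le (R : realType) (z z0 : R[i]) (r c s : R) :
  0 <= r -> c ^+ 2 + s ^+ 2 = 1 -> `|z - z0| <= r%:C ->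
  c * complex.Re z + s * complex.Im z
    <= r + complex.Re z0 * c + complex.Im z0 * s.
Proof.
case: z z0 => [a b] [a0 b0] r0 cs; rewrite normc_def lecR /=.
set A := a - a0; set B := b - b0 => AB.
have AB2 : A ^+ 2 + B ^+ 2 <= r ^+ 2.
  by rewrite -(@sqr_sqrtr _ (A ^+ 2 + B ^+ 2)) ?addr_ge0 ?sqr_ge0 // lerXn2r ?nnegrE ?sqrtr_ge0.
have : c * A + s * B <= r.
  apply: le_trans (ler_norm _) _.
  rewrite -(ler_pXn2r (ltn0Sn 1)) ?nnegrE // real_normK ?num_real //.
  apply: le_trans AB2.
  have := sqr_ge0 (c * B - s * A).
  have -> : (c * A + s * B) ^+ 2 = (c ^+ 2 + s ^+ 2) * (A ^+ 2 + B ^+ 2)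
    - (c * B - s * A) ^+ 2 by ring.
  by rewrite cs; lra.
by rewrite /A /B; lra.
Qed.

(** The inequality in [is_top] comes from the disk lying in a half plane; the
    maximum is attained because the boundary point of the disk in the direction
    [(c, s)] is a value, the real or the imaginary part of the corresponding
    vector being the maximizer. *)
Lemma disk_is_top (R : realType) (e f g h r : R) (z0 : R[i]) :
  0 <= r ->
  numerical_range (mxA 1 0 0 e f g h) = [set z | `|z - z0| <= r%:C]%classic ->
  forall c s : R, c ^+ 2 + s ^+ 2 = 1 ->
    is_top e f g (h * c) (r + complex.Re z0 * c + complex.Im z0 * s).
Proof.
case: z0 => a0 b0 r0 WE c s cs /=; set l := r + _ + _.
have w1 : (c +i* s) * (c +i* s)^*c = 1.
  rewrite /=; apply/eqP; rewrite eq_complex /=.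
  by apply/andP; split; apply/eqP; [rewrite -cs|]; ring.
have WP z := numerical_range_phase e f g h z w1.
have le_unit x1 x2 x3 x4 x5 x6 : sqnorm6 x1 x2 x3 x4 x5 x6 = 1 ->
    formQ e f g (h * c) x1 x2 x3 x4 x5 x6 <= l.
  rewrite /sqnorm6 => n1.
  pose q := x4 * x1 + x5 * x2 + (e * x3 + f * x4 + g * x5) * x6.
  have : numerical_range (mxA 1 0 0 e f g h) ((c +i* s) * q%:C + (h * x6 ^+ 2)%:C).
    apply/WP; exists x1%:C, x2%:C, x3%:C, x4%:C, x5%:C, x6%:C.
    rewrite !conjc_real -!rmorphM -!rmorphD -!rmorphM -!rmorphD.
    by rewrite -!expr2 n1 rmorph1 -/q.
  rewrite WE => /(disk_dir_le r0 cs) /=; apply: le_trans.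
  rewrite /formQ -/q le_eqVlt; apply/orP; left; apply/eqP.
  transitivity ((c ^+ 2 + s ^+ 2) * q + h * c * x6 ^+ 2); last by ring.
  by rewrite cs mul1r.
have le_all x1 x2 x3 x4 x5 x6 : formQ e f g (h * c) x1 x2 x3 x4 x5 x6
     <= l * sqnorm6 x1 x2 x3 x4 x5 x6.
  have [N0|NN0] := eqVneq (sqnorm6 x1 x2 x3 x4 x5 x6) 0.
    rewrite N0 mulr0; move/eqP: N0; rewrite /sqnorm6.
    rewrite !paddr_eq0 ?addr_ge0 ?sqr_ge0 // !sqrf_eq0.
    move=> /andP[/andP[/andP[/andP[/andP[/eqP-> /eqP->] /eqP->] /eqP->] /eqP->] /eqP->].
    by rewrite /formQ; lra.
  set N := sqnorm6 _ _ _ _ _ _ in NN0 *.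
  have Ngt : 0 < N by rewrite lt_def NN0 /N /sqnorm6 !addr_ge0 ?sqr_ge0.
  pose n := Num.sqrt N; have n2 : n ^+ 2 = N by rewrite sqr_sqrtr ?ltW.
  have nN0 : n != 0 by rewrite -sqrf_eq0 n2.
  have := le_unit (x1 / n) (x2 / n) (x3 / n) (x4 / n) (x5 / n) (x6 / n).
  have -> : formQ e f g (h * c) (x1 / n) (x2 / n) (x3 / n) (x4 / n) (x5 / n) (x6 / n)
    = formQ e f g (h * c) x1 x2 x3 x4 x5 x6 / N by rewrite -n2 /formQ; field.
  have -> : sqnorm6 (x1 / n) (x2 / n) (x3 / n) (x4 / n) (x5 / n) (x6 / n) = N / N.
    by rewrite -{2}n2 /N /sqnorm6; field.
  by rewrite divff // ler_pdivrMr //; apply.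
split=> //.
have : numerical_range (mxA 1 0 0 e f g h) ((a0 +i* b0) + (c +i* s) * r%:C).
  rewrite WE /= addrAC subrr add0r normrM normc_def /= cs sqrtr1 mul1r.
  by rewrite ger0_norm ?ler0c.
move=> /WP[y1 [y2 [y3 [y4 [y5 [y6 []]]]]]].
case: y1 y2 y3 y4 y5 y6 => [x1 y1] [x2 y2] [x3 y3] [x4 y4] [x5 y5] [x6 y6].
move=> [n1 _] [zR zI].
have Nsum : sqnorm6 x1 x2 x3 x4 x5 x6 + sqnorm6 y1 y2 y3 y4 y5 y6 = 1.
  by rewrite -n1 /sqnorm6; ring.
have Qsum : formQ e f g (h * c) x1 x2 x3 x4 x5 x6
   + formQ e f g (h * c) y1 y2 y3 y4 y5 y6 = l.
  pose q := x4 * x1 + x5 * x2 + (e * x3 + f * x4 + g * x5) * x6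
    + (y4 * y1 + y5 * y2 + (e * y3 + f * y4 + g * y5) * y6).
  transitivity ((c ^+ 2 + s ^+ 2) * q + h * c * (x6 ^+ 2 + y6 ^+ 2)).
    by rewrite cs /formQ /q; ring.
  transitivity (c * (a0 + (c * r - s * 0)) + s * (b0 + (c * 0 + s * r))).
    by rewrite zR zI /q; ring.
  transitivity ((c ^+ 2 + s ^+ 2) * r + a0 * c + b0 * s); first by ring.
  by rewrite cs mul1r.
have Qx := le_all x1 x2 x3 x4 x5 x6; have Qy := le_all y1 y2 y3 y4 y5 y6.
have lsum := congr1 ( *%R l) Nsum; rewrite mulrDr mulr1 in lsum.
have [Nx0|NxN0] := eqVneq (sqnorm6 x1 x2 x3 x4 x5 x6) 0.
  exists y1, y2, y3, y4, y5, y6; split; last by lra.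
  by rewrite Nx0 add0r in Nsum; rewrite Nsum oner_eq0.
by exists x1, x2, x3, x4, x5, x6; split => //; lra.
Qed.

Theorem corollary7p7 (R : realType) (b c d e f g h : R)
    (hb : 0 <= b) (hc : 0 <= c) (hd : 0 <= d) (he : 0 <= e) (hh : 0 <= h)
    (hf_nonneg : c * e = 0 -> 0 <= f) (hf_nonpos : c * e <> 0 -> f <= 0)
    (hbcd : b ^+ 2 + c ^+ 2 + d ^+ 2 = 1)
    (hefgh : e ^+ 2 + f ^+ 2 + g ^+ 2 + h ^+ 2 = 1)
    (horth : c * e + d * f = 0)
    (hce : e = 0 -> c = 0)
    (hcase : (c = 0 /\ d = 0) \/ (g = 0 /\ h = 0)) :
  circular_disk (numerical_range (mxA b c d e f g h)) <->
  nilpotent_mx (mxA b c d e f g h).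
Proof.
rewrite mxA_nilpotent; case: hcase => [[c0 d0]|[g0 h0]]; last first.
  subst g h; split=> // _; apply: mxA_disk_gh0 => //.
  by rewrite !expr0n !addr0 in hefgh.
subst c d; have b1 : b = 1.
  apply/eqP; rewrite -(@eqrXn2 _ 2) // expr1n -hbcd !expr0n !addr0.
  exact/eqP.
subst b; split=> [[z0 [r [r0 WE]]]|h0]; last first.
  by subst h; apply: mxA_disk_cdh0; rewrite expr0n addr0 in hefgh.
apply/eqP/negPn/negP => hN0.
have h0 : 0 < h by rewrite lt_def hN0.
exact: (top_not_affine h0 hefgh (disk_is_top (ltW r0) WE)).
Qed.
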